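(* For all $k_1,k_2,k_1',k_2'\in\mathbb{N}$ with $k_1+k_2\geq 2$ and $k_1'+k_2'\geq 2$, it holds that $\mathsf{C}^{(k_1,k_2)}\prec\mathsf{C}^{(k_1',k_2')}$ if and only if one of the following holds: (1) $k_1<k_1'$ and $k_1+k_2\leq k_1'+k_2'$; (2) $k_1\leq k_1'$ and $k_1+k_2<k_1'+k_2'$; (3) $k_1=1$, $k_1'=0$ and $k_2'>2k_2$. Furthermore, $\mathsf{C}^{(k_1,k_2)}\equiv\mathsf{C}^{(k_1',k_2')}$ if and only if $(k_1,k_2)=(k_1',k_2')$.
   Context: Colored graphs are finite simple graphs with a vertex coloring. First-order logic with counting $\mathsf{C}$ has atomic formulas $x=y$, $E(x,y)$, $U_c(x)$, Boolean connectives, and quantifiers $\forall,\exists,\exists^{\geq n}$ ($n\in\mathbb{N}$). A variable $x$ is requantified in $\varphi$ if it is both free and bound in $\varphi$, or $\varphi$ has a subformula $Qx\,\psi$ where $\psi$ has a subformula $Q'x\,\chi$ ($Q,Q'$ quantifiers). $\mathsf{C}^{(k_1,k_2)}$ is the set of $\mathsf{C}$-formulas whose variables lie in $\{x_1,\dots,x_{k_1},y_1,\dots,y_{k_2}\}$ and in which no $y_j$ is requantified. A logic $L$ distinguishes two colored graphs if some sentence of $L$ holds in exactly one of them. $L\preceq L'$ means every pair of colored graphs distinguished by $L$ is distinguished by $L'$; $L\prec L'$ means $L\preceq L'$ but not $L'\preceq L$; $L\equiv L'$ means $L\preceq L'$ and $L'\preceq L$. *)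

(* Defs.v *)
From HB Require Import structures.
From mathcomp Require Import all_boot.
Set Implicit Arguments.
Unset Strict Implicit.
Unset Printing Implicit Defensive.

(* Colors are natural numbers; the empty graph is not excluded. *)
Record colored_graph := ColoredGraph {
  vertex :> finType;
  edge : rel vertex;
  color : vertex -> nat;
  edge_sym : symmetric edge;
  edge_irr : irreflexive edge
}.

(* Indices start at 0: [xvar i] is x_(i+1) and [yvar j] is y_(j+1). *)
Definition var : Type := (nat + nat)%type.
HB.instance Definition _ := Equality.on var.
Definition xvar (i : nat) : var := inl i.
Definition yvar (j : nat) : var := inr j.

Inductive quantifier :=
| Forall
| Exists
| AtLeast of nat.

Inductive formula :=
| FEq of var & var
| FEdge of var & var
| FColor of nat & var
| FNot of formula
| FAnd of formula & formula
| FOr of formula & formula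
| FImp of formula & formula
| FIff of formula & formula
| FQuant of quantifier & var & formula.

Definition eval_quant (q : quantifier) (T : finType) (P : pred T) : bool :=
  match q with
  | Forall => [forall v, P v]
  | Exists => [exists v, P v]
  | AtLeast n => n <= #|P|
  end.

Definition update (T : Type) (e : var -> option T) (x : var) (v : T) :
    var -> option T :=
  fun z => if z == x then Some v else e z.

(* Assignments are partial so that sentences can be evaluated in every graph,
   including the empty one, from the nowhere-defined assignment; an atom with
   an unassigned variable is false, which never matters for sentences. *)
Fixpoint eval (G : colored_graph) (e : var -> option G) (phi : formula)
    : bool :=
  match phi with
  | FEq x y => if (e x, e y) is (Some u, Some v) then u == v else false
  | FEdge x y => if (e x, e y) is (Some u, Some v) then edge u v else false
  | FColor c x => if e x is Some u then color u == c else false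
  | FNot psi => ~~ eval e psi
  | FAnd psi chi => eval e psi && eval e chi
  | FOr psi chi => eval e psi || eval e chi
  | FImp psi chi => eval e psi ==> eval e chi
  | FIff psi chi => eval e psi == eval e chi
  | FQuant q x psi => eval_quant q (fun v : G => eval (update e x v) psi)
  end.

Definition holds (G : colored_graph) (phi : formula) : bool :=
  eval (fun _ => @None G) phi.

Fixpoint occurs (z : var) (phi : formula) : bool :=
  match phi with
  | FEq x y | FEdge x y => (z == x) || (z == y)
  | FColor _ x => z == x
  | FNot psi => occurs z psi
  | FAnd psi chi | FOr psi chi | FImp psi chi | FIff psi chi =>
      occurs z psi || occurs z chi
  | FQuant _ x psi => (z == x) || occurs z psi
  end.

Fixpoint free (z : var) (phi : formula) : bool :=
  match phi with
  | FEq x y | FEdge x y => (z == x) || (z == y)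
  | FColor _ x => z == x
  | FNot psi => free z psi
  | FAnd psi chi | FOr psi chi | FImp psi chi | FIff psi chi =>
      free z psi || free z chi
  | FQuant _ x psi => (z != x) && free z psi
  end.

Definition sentence (phi : formula) : Prop := forall z, ~~ free z phi.

Fixpoint subformula (theta phi : formula) : Prop :=
  theta = phi \/
  match phi with
  | FEq _ _ | FEdge _ _ | FColor _ _ => False
  | FNot psi | FQuant _ _ psi => subformula theta psi
  | FAnd psi chi | FOr psi chi | FImp psi chi | FIff psi chi =>
      subformula theta psi \/ subformula theta chi
  end.

Definition bound (z : var) (phi : formula) : Prop :=
  exists q psi, subformula (FQuant q z psi) phi.

Definition requantified (z : var) (phi : formula) : Prop :=
  (free z phi /\ bound z phi) \/
  exists q psi q' chi,
    subformula (FQuant q z psi) phi /\ subformula (FQuant q' z chi) psi.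

(* A logic is given by its set of formulas. *)
Definition logic := formula -> Prop.

Definition C_logic (k1 k2 : nat) : logic := fun phi =>
  (forall z, occurs z phi ->
     (exists2 i, i < k1 & z = xvar i) \/ (exists2 j, j < k2 & z = yvar j)) /\
  (forall j, j < k2 -> ~ requantified (yvar j) phi).

Definition distinguishes (L : logic) (G H : colored_graph) : Prop :=
  exists phi, [/\ L phi, sentence phi & holds G phi != holds H phi].

Definition logic_le (L L' : logic) : Prop :=
  forall G H, distinguishes L G H -> distinguishes L' G H.

Definition logic_lt (L L' : logic) : Prop := logic_le L L' /\ ~ logic_le L' L.

Definition logic_equiv (L L' : logic) : Prop :=
  logic_le L L' /\ logic_le L' L.

(* Main.v *)
Require Import Defs.
From mathcomp Require Import all_boot zify.
From Stdlib Require Import Classical.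
Set Implicit Arguments.
Unset Strict Implicit.
Unset Printing Implicit Defensive.

(** One shows that [C_logic k1 k2] is below [C_logic k1' k2'] exactly when
    [k1 <= k1'] and [k1 + k2 <= k1' + k2'], or [k1 = 1], [k1' = 0] and
    [2 * k2 < k2'].

    Upwards, surplus y-variables are renamed to x-variables. When there is a
    single x-variable, requantifying it forgets everything about its old value,
    so only one use of it between two y-quantifiers matters and quantifier rank
    [2 * k2 + 1] suffices.

    For the separations one takes the Cai-Fürer-Immerman graphs with and without
    a twist over the complete binary tree of height [H] in which every vertex is
    joined to its [h] nearest ancestors. They are distinguished by the sentence
    saying that the base graph maps homomorphically to the graph, which needs
    one variable per level and may reuse a variable after [h + 1] levels. They
    are not distinguished when a robber escapes cops standing for the
    variables, where x-cops can be moved but y-cops only be placed once: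
    - [k1 + k2 > k1' + k2']: [h >= H = k1 + k2 - 1], and a branch of the tree is
      a clique with more vertices than there are cops;
    - [k1 >= 2], [k1 > k1']: [h = k1 - 1], and the robber runs along a branch
      that is very long compared to the number of y-cops;
    - [k1 = 1], [k1' = 0], [k2' <= 2 * k2]: [h = 1], [H = 2 * k2], and the robber
      moves down whenever a cop is placed in the subtree below him. *)

(** * Requantification as a top-down condition *)

Definition is_x (z : var) : bool := if z is inl _ then true else false.

Definition avail (k1 k2 : nat) : pred var :=
  fun z => match z with inl i => i < k1 | inr j => j < k2 end.

Definition spend (a : pred var) (z : var) : pred var :=
  fun w => a w && ((w != z) || is_x z).

(** The set [a] holds the variables that may still be quantified in the current scope. In contrast
    to [requantified], the condition ignores free variables and descends to subformulas; on
    sentences, with [a := avail k1 k2], it amounts to [C_logic k1 k2]. *)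
Fixpoint admissible (a : pred var) (phi : formula) : bool :=
  match phi with
  | FEq _ _ | FEdge _ _ | FColor _ _ => true
  | FNot psi => admissible a psi
  | FAnd psi chi | FOr psi chi | FImp psi chi | FIff psi chi =>
      admissible a psi && admissible a chi
  | FQuant _ z psi => a z && admissible (spend a z) psi
  end.

Definition nested (z : var) (phi : formula) : Prop :=
  exists q psi q' chi,
    subformula (FQuant q z psi) phi /\ subformula (FQuant q' z chi) psi.

Lemma bound_occurs z phi : bound z phi -> occurs z phi.
Proof.
case=> q [psi]; elim: phi => /=.
- 1-3: by move=> *; intuition discriminate.
- by move=> phi IH [//|/IH].
- by move=> p1 I1 p2 I2 [//|[/I1|/I2] ->]; rewrite ?orbT.
- by move=> p1 I1 p2 I2 [//|[/I1|/I2] ->]; rewrite ?orbT.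
- by move=> p1 I1 p2 I2 [//|[/I1|/I2] ->]; rewrite ?orbT.
- by move=> p1 I1 p2 I2 [//|[/I1|/I2] ->]; rewrite ?orbT.
- by move=> q' w phi IH [[_ -> _]|/IH ->]; rewrite ?eqxx ?orbT.
Qed.

Lemma occurs_free_bound z phi : occurs z phi -> free z phi \/ bound z phi.
Proof.
rewrite /bound; elim: phi => /=.
- 1-3: by move=> *; left.
- by move=> p IH /IH [|[q [psi s]]]; [left|right; exists q, psi; right].
- 1-4: by move=> p1 I1 p2 I2 /orP [/I1|/I2] [->|[q [psi s]]];
    rewrite ?orbT; (try by left); right; exists q, psi; intuition.
- move=> q w p IH; case: eqP => [-> _|_ /= /IH [|[q' [psi s]]]].
  + by right; exists q, p; left.
  + by left.
  + by right; exists q', psi; right.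
Qed.

Lemma nested_bound z phi : nested z phi -> bound z phi.
Proof. by case=> q [psi [? [? [s _]]]]; exists q, psi. Qed.

Lemma admissible_intro phi (a : pred var) :
  (forall z, bound z phi -> a z) ->
  (forall z, ~~ is_x z -> ~ nested z phi) -> admissible a phi.
Proof.
elim: phi a => //=.
- move=> p IH a Hb Hn; apply: IH => z.
  + by case=> q [psi s]; apply: Hb; exists q, psi; right.
  + move=> xz [q [psi [q' [chi [s t]]]]]; apply: (Hn z xz).
    by exists q, psi, q', chi; split=> //; right.
- 1-4: move=> p1 I1 p2 I2 a Hb Hn; apply/andP; split;
  [apply: I1 => z|apply: I2 => z];
  [ by case=> q [psi s]; apply: Hb; exists q, psi; right; left
  | by move=> xz [q [psi [q' [chi [s t]]]]]; apply: (Hn z xz);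
    exists q, psi, q', chi; split=> //; right; left
  | by case=> q [psi s]; apply: Hb; exists q, psi; right; right
  | by move=> xz [q [psi [q' [chi [s t]]]]]; apply: (Hn z xz);
    exists q, psi, q', chi; split=> //; right; right ].
- move=> q z p IH a Hb Hn; apply/andP; split.
    by apply: Hb; exists q, p; left.
  apply: IH => w.
  + move=> bw; apply/andP; split.
      by case: bw => q' [psi s]; apply: Hb; exists q', psi; right.
    case: eqP => //= ewz; apply: contraT => xz; case: (Hn z xz).
    case: bw => q' [psi s]; exists q, p, q', psi.
    by split; [left|rewrite -ewz].
  + move=> xw [q' [psi [q'' [chi [s t]]]]]; apply: (Hn w xw).
    by exists q', psi, q'', chi; split=> //; right.
Qed.

Lemma admissible_sub phi (a : pred var) q z psi :
  admissible a phi -> subformula (FQuant q z psi) phi ->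
  exists b : pred var, [/\ forall w, b w -> a w, b z & admissible (spend b z) psi].
Proof.
elim: phi a => /=.
- 1-3: by move=> *; intuition discriminate.
- by move=> p IH a Ha [//|/(IH _ Ha)].
- 1-4: by move=> p1 I1 p2 I2 a /andP [A1 A2] [//|[/(I1 _ A1)|/(I2 _ A2)]].
- move=> q' w p IH a /andP [aw Hp] [[_ -> ->]|/(IH _ Hp)].
    by exists a; split.
  case=> b [sb bz Hb]; exists b; split=> // v /sb.
  by case/andP.
Qed.

Lemma C_logic_admissible k1 k2 phi :
  C_logic k1 k2 phi -> admissible (avail k1 k2) phi.
Proof.
case=> Ho Hn.
have Hb z : bound z phi -> avail k1 k2 z.
  by move/bound_occurs/Ho => [[i ? ->]|[j ? ->]].
apply: admissible_intro => // -[//|j] _ nj.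
by apply: (Hn j (Hb _ (nested_bound nj))); right.
Qed.

Lemma admissible_C_logic k1 k2 phi :
  admissible (avail k1 k2) phi -> sentence phi -> C_logic k1 k2 phi.
Proof.
move=> Ha Hs.
have Hb z : bound z phi -> avail k1 k2 z.
  by case=> q [psi] /(admissible_sub Ha) [b [sb /sb]].
split.
- move=> z /occurs_free_bound [|/Hb]; first by move/negPf: (Hs z) => ->.
  by case: z => i /= lt; [left|right]; exists i.
- move=> j _ [[]|]; first by rewrite (negPf (Hs _)).
  case=> q [psi [q' [chi [s t]]]].
  have [b [_ _ Hb']] := admissible_sub Ha s.
  have [b' [sb' bj _]] := admissible_sub Hb' t.
  by have /andP[_] := sb' _ bj; rewrite eqxx.
Qed.

Lemma admissible_mono phi (a b : pred var) :
  (forall z, a z -> b z) -> admissible a phi -> admissible b phi.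
Proof.
elim: phi a b => //=.
- 1-4: by move=> p1 I1 p2 I2 a b s /andP [A1 A2]; rewrite (I1 a b) ?(I2 a b).
- move=> q z p IH a b s /andP [az Hp]; rewrite s //=.
  by apply: IH Hp => w /andP[/s bw H]; apply/andP.
Qed.

Lemma distinguishesP k1 k2 G H :
  distinguishes (C_logic k1 k2) G H <->
  exists phi, [/\ admissible (avail k1 k2) phi, sentence phi
                & holds G phi != holds H phi].
Proof.
split=> -[phi [h1 h2 h3]]; exists phi; split=> //.
- exact: C_logic_admissible.
- exact: admissible_C_logic.
Qed.

(** The complements are counted as well, because [Forall] depends on the number of counterexamples
    and the two domains may differ in size. *)
Lemma eval_quant_card q (T U : finType) (P : pred T) (Q : pred U) :
  #|P| = #|Q| -> #|predC P| = #|predC Q| -> eval_quant q P = eval_quant q Q.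
Proof.
case: q => [||n] /= e1 e2; last by rewrite e1.
- have fE (S : finType) (R : pred S) : [forall v, R v] = (#|predC R| == 0).
    apply/forallP/eqP => [h|/card0_eq h v].
      by apply: eq_card0 => v; rewrite !inE h.
    by have := h v; rewrite !inE => /negbFE.
  by rewrite !fE e2.
- have xE (S : finType) (R : pred S) : [exists v, R v] = (#|R| != 0).
    apply/existsP/idP => [[v h]|]; first by rewrite -lt0n; apply/card_gt0P; exists v.
    by rewrite -lt0n => /card_gt0P[v]; exists v.
  by rewrite !xE e1.
Qed.

Lemma eq_eval_quant q (T : finType) (P Q : pred T) :
  P =1 Q -> eval_quant q P = eval_quant q Q.
Proof.
by move=> e; apply: eval_quant_card; apply: eq_card => v; rewrite /in_mem /= ?e.
Qed.

Lemma eval_ext (G : colored_graph) phi (e e' : var -> option G) :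
  (forall z, free z phi -> e z = e' z) -> eval e phi = eval e' phi.
Proof.
elim: phi e e' => /=.
- by move=> x y e e' h; rewrite !h ?eqxx ?orbT.
- by move=> x y e e' h; rewrite !h ?eqxx ?orbT.
- by move=> c x e e' h; rewrite !h ?eqxx ?orbT.
- by move=> p IH e e' /IH ->.
- 1-4: by move=> p1 I1 p2 I2 e e' h; rewrite (I1 e e') ?(I2 e e') // => z hz;
    rewrite h // hz ?orbT.
- move=> q z p IH e e' h; apply: eq_eval_quant => v; apply: IH => w hw.
  by rewrite /update; case: eqP => // /eqP nw; rewrite h // nw.
Qed.

(** * Renaming variables *)

Fixpoint rename (s : var -> var) (phi : formula) : formula :=
  match phi with
  | FEq x y => FEq (s x) (s y)
  | FEdge x y => FEdge (s x) (s y)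
  | FColor c x => FColor c (s x)
  | FNot psi => FNot (rename s psi)
  | FAnd psi chi => FAnd (rename s psi) (rename s chi)
  | FOr psi chi => FOr (rename s psi) (rename s chi)
  | FImp psi chi => FImp (rename s psi) (rename s chi)
  | FIff psi chi => FIff (rename s psi) (rename s chi)
  | FQuant q x psi => FQuant q (s x) (rename s psi)
  end.

Section Rename.
Variable s : var -> var.
Hypothesis sK : involutive s.

Lemma eval_rename (G : colored_graph) phi (e : var -> option G) :
  eval e (rename s phi) = eval (fun z => e (s z)) phi.
Proof.
elim: phi e => //=.
- by move=> p IH e; rewrite IH.
- 1-4: by move=> p1 I1 p2 I2 e; rewrite I1 I2.
move=> q z p IH e; apply: eq_eval_quant => v; rewrite IH.
by apply: eval_ext => w _; rewrite /update (inj_eq (inv_inj sK)).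
Qed.

Lemma free_rename z phi : free z (rename s phi) = free (s z) phi.
Proof.
elim: phi => //=.
- 1-2: by move=> x y; rewrite !(inv_eq sK).
- by move=> _ x; rewrite !(inv_eq sK).
- 1-4: by move=> p1 -> p2 ->.
- by move=> _ x p ->; rewrite (inv_eq sK).
Qed.

Lemma admissible_rename phi (a b : pred var) :
  (forall z, a z -> b (s z) /\ (is_x z -> is_x (s z))) ->
  admissible a phi -> admissible b (rename s phi).
Proof.
elim: phi a b => //=.
- 1-4: by move=> p1 I1 p2 I2 a b h /andP [A1 A2]; rewrite (I1 a b) ?(I2 a b).
- move=> q z p IH a b h /andP [az Hp]; rewrite (h z az).1 /=.
  apply: IH Hp => w /andP[aw hw]; split; last exact: (h w aw).2.
  rewrite /spend (h w aw).1 /= (inj_eq (inv_inj sK)).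
  by case/orP: hw => [->//|/(h z az).2 ->]; rewrite orbT.
Qed.
End Rename.

(* Exchanging x_(k1+t) with y_(k2'+t) moves the surplus y-variables onto
   x-variables. *)
Lemma logic_le_rename k1 k2 k1' k2' :
  k1 <= k1' -> k1 + k2 <= k1' + k2' ->
  logic_le (C_logic k1 k2) (C_logic k1' k2').
Proof.
move=> h1 h2 G H /distinguishesP [phi [Ha Hs Hd]]; apply/distinguishesP.
pose s (z : var) : var := match z with
  | inl i => if i < k1 then inl i else inr (k2' + (i - k1))
  | inr j => if j < k2' then inr j else inl (k1 + (j - k2')) end.
have sK : involutive s.
  case=> i; rewrite /s; case: (ltnP i _) => hi /=; rewrite ?hi //;
    by case: ltnP => ?; try lia; congr (_ _); lia.
exists (rename s phi); split.
- apply: admissible_rename Ha => // -[i|j] /= lt.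
    by rewrite lt; split=> //=; lia.
  by case: ltnP => ?; split=> //=; lia.
- by move=> z; rewrite free_rename.
- by rewrite /holds !eval_rename.
Qed.

(** * One requantifiable variable and quantifier rank *)

Fixpoint qrank (phi : formula) : nat :=
  match phi with
  | FEq _ _ | FEdge _ _ | FColor _ _ => 0
  | FNot psi => qrank psi
  | FAnd psi chi | FOr psi chi | FImp psi chi | FIff psi chi =>
      maxn (qrank psi) (qrank chi)
  | FQuant _ _ psi => (qrank psi).+1
  end.

Definition small (n : nat) (A : pred var) (phi : formula) : Prop :=
  qrank phi <= n /\ forall z, free z phi -> A z.

(** Equivalence up to quantifier rank [n] in counting logic, where the number of bound variables is
    unrestricted. *)
Definition agree (n : nat) (A : pred var) (G H : colored_graph)
    (e : var -> option G) (e' : var -> option H) : Prop :=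
  forall phi, small n A phi -> eval e phi = eval e' phi.

Lemma agree_mono n m (A B : pred var) (G H : colored_graph)
    (e : var -> option G) (e' : var -> option H) :
  m <= n -> (forall z, B z -> A z) -> agree n A e e' -> agree m B e e'.
Proof.
move=> lemn sBA h phi [hq hf]; apply: h; split; first exact: leq_trans hq _.
by move=> z /hf /sBA.
Qed.

Lemma agree_update n (A : pred var) (G H : colored_graph)
    (e : var -> option G) (e' : var -> option H) z u v :
  ~~ A z -> agree n A e e' -> agree n A (update e z u) (update e' z v).
Proof.
move=> nAz h phi hs; have [_ hf] := hs.
have E (K : colored_graph) (d : var -> option K) t : eval (update d z t) phi = eval d phi.
  apply: eval_ext => w /hf Aw; rewrite /update; case: eqP => // ewz.
  by move: nAz; rewrite -ewz Aw.
by rewrite !E h.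
Qed.

Lemma conj_definable (T I : Type) (r : seq I) (val : T -> formula -> bool)
    (P : formula -> Prop) (F : I -> formula) (tt : formula) :
  P tt -> (forall t, val t tt) ->
  (forall p q, P p -> P q -> P (FAnd p q)) ->
  (forall t p q, val t (FAnd p q) = val t p && val t q) ->
  (forall i, P (F i)) ->
  exists2 chi, P chi & forall t, val t chi = all (fun i => val t (F i)) r.
Proof.
move=> Ptt vtt PA vA PF; elim: r => [|i r [chi Pc vc]] /=.
  by exists tt.
by exists (FAnd (F i) chi) => [|t]; [exact: PA|rewrite vA vc].
Qed.

(* An invariant set is the union, over its members, of the intersections of
   formulas separating that member from each non-member. *)
Lemma definable (T : finType) (val : T -> formula -> bool)
    (P : formula -> Prop) (S : pred T) (tt : formula) :
  P tt -> (forall t, val t tt) ->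
  (forall p, P p -> P (FNot p)) ->
  (forall p q, P p -> P q -> P (FAnd p q)) ->
  (forall t p, val t (FNot p) = ~~ val t p) ->
  (forall t p q, val t (FAnd p q) = val t p && val t q) ->
  (forall t t', (forall p, P p -> val t p = val t' p) -> S t = S t') ->
  exists2 chi, P chi & forall t, val t chi = S t.
Proof.
move=> Ptt vtt PN PA vN vA inv.
have sep (ij : T * T) : exists p, P p /\
    (S ij.1 -> ~~ S ij.2 -> val ij.1 p /\ ~~ val ij.2 p).
  case: ij => t t' /=; case: (boolP (S t && ~~ S t')) => [/andP[St nSt']|];
    last first.
    by move=> h; exists tt; split=> // S1 S2; move: h; rewrite S1 S2.
  have [//|h] := classic (exists p, P p /\
    (S t -> ~~ S t' -> val t p /\ ~~ val t' p)).
  (* If no formula separates [t] from [t'] in this direction, then by negation none does in the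
     other, and invariance applies. *)
  suff : S t = S t' by rewrite St (negPf nSt').
  apply: inv => p Pp; case E: (val t p); case E': (val t' p) => //; case: h.
  - by exists p; rewrite E E'.
  - by exists (FNot p); rewrite !vN E E'; split=> //; apply: PN.
have [F HF] := fin_all_exists sep.
pose nF t t' : formula := F (t, t').
have row t : exists p, P p /\ forall s,
    val s p = all (fun t' => val s (nF t t')) [seq t' <- enum T | ~~ S t'].
  have [|p Pp vp] := @conj_definable T T [seq t' <- enum T | ~~ S t']
    val P (nF t) tt Ptt vtt PA vA; first by move=> t'; apply: (HF _).1.
  by exists p.
have [R HR] := fin_all_exists row.
have [|p Pp vp] := @conj_definable T T (filter S (enum T)) val P
  (fun t => FNot (R t)) tt Ptt vtt PA vA.
  by move=> t; apply: PN; apply: (HR t).1.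
exists (FNot p) => [|s]; first exact: PN.
rewrite vN vp -has_predC; apply/hasP/idP => [[t]|Ss].
- rewrite mem_filter => /andP[St _] /=; rewrite vN negbK (HR t).2 => /allP h.
  apply: contraT => nSs; have /h : s \in [seq t' <- enum T | ~~ S t'].
    by rewrite mem_filter nSs mem_enum.
  by rewrite /nF (negPf ((HF (t, s)).2 St nSs).2).
- exists s; first by rewrite mem_filter Ss mem_enum.
  rewrite /= vN negbK (HR s).2; apply/allP => t'.
  by rewrite mem_filter => /andP[nSt' _]; have [] := (HF (s, t')).2 Ss nSt'.
Qed.

(** By the three invariance hypotheses, [P] and [Q] together form an invariant set of the disjoint
    union [G + H], so a single formula [chi] of rank [n] defines both. The numbers of elements
    satisfying [chi] and its negation are fixed by [AtLeast] formulas of rank [n.+1], in which [z]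
    is not free. *)
Lemma agree_quant n (A : pred var) (G H : colored_graph)
    (e : var -> option G) (e' : var -> option H) z q
    (P : pred G) (Q : pred H) :
  A z -> agree n.+1 (fun w => A w && (w != z)) e e' ->
  (forall u v, agree n A (update e z u) (update e z v) -> P u = P v) ->
  (forall u v, agree n A (update e z u) (update e' z v) -> P u = Q v) ->
  (forall u v, agree n A (update e' z u) (update e' z v) -> Q u = Q v) ->
  eval_quant q P = eval_quant q Q.
Proof.
move=> Az hag h1 h2 h3.
pose val (t : G + H) phi := match t with
  | inl u => eval (update e z u) phi | inr v => eval (update e' z v) phi end.
pose S (t : G + H) := match t with inl u => P u | inr v => Q v end.
have [||||||t t' ht|chi Pc vc] := @definable _ val (small n A) S (FEq z z).
- by split=> // w /=; rewrite orbb => /eqP ->.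
- by case=> u; rewrite /= /update !eqxx.
- by [].
- move=> p p' [r1 f1] [r2 f2]; split=> [|w] /=; first by rewrite geq_max r1.
  by case/orP => [/f1|/f2].
- by case.
- by case.
- case: t t' ht => [u|u] [v|v] ht /=; [exact: h1|exact: h2| |exact: h3].
  by apply/esym/h2 => p Pp; apply/esym/ht.
have card_eq p : small n A p ->
    #|(fun u => eval (update e z u) p)| = #|(fun u => eval (update e' z u) p)|.
  move=> [rp fp].
  have sm k : small n.+1 (fun w => A w && (w != z)) (FQuant (AtLeast k) z p).
    by split=> //= w /andP[-> /fp ->].
  set c1 := #|_|; set c2 := #|_|.
  have E k : (k <= c1) = (k <= c2) := hag _ (sm k).
  by apply/eqP; rewrite eqn_leq -E leqnn E leqnn.
have [E1 E2] : (P =1 fun u => eval (update e z u) chi) /\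
               (Q =1 fun u => eval (update e' z u) chi).
  by split=> u; [rewrite -[LHS](vc (inl u))|rewrite -[LHS](vc (inr u))].
rewrite (eq_eval_quant q E1) (eq_eval_quant q E2).
apply: eval_quant_card; first exact: card_eq.
exact: (card_eq (FNot chi)).
Qed.

Lemma count_spend k2 (a : pred var) j m :
  j < k2 -> a (inr j) ->
  count (fun i => a (inr i)) (iota 0 k2) <= m ->
  0 < m /\ count (fun i => spend a (inr j) (inr i)) (iota 0 k2) <= m.-1.
Proof.
move=> ltj aj.
have jin : j \in iota 0 k2 by rewrite mem_iota add0n.
have -> : count (fun i => a (inr i)) (iota 0 k2) =
    (count (fun i => spend a (inr j) (inr i)) (iota 0 k2)).+1.
  have perm := perm_to_rem jin.
  have -> : count (fun i => spend a (inr j) (inr i)) (iota 0 k2) =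
      count (fun i => spend a (inr j) (inr i)) (rem j (iota 0 k2)).
    by rewrite (permP perm) /= {1}/spend eqxx andbF.
  rewrite (permP perm) /= aj add1n; congr _.+1.
  apply: eq_in_count => i /=; rewrite mem_rem_uniq ?iota_uniq // inE => /andP[n _].
  by rewrite /spend orbF; case: (a _) => //=; apply/esym/eqP => -[] /eqP; rewrite (negPf n).
by case: m => // m; rewrite ltnS.
Qed.

(* The requantifiable variable forgets its old value, so [m] further uses of
   y-variables are simulated by rank [2m] with it and [2m+1] without it. *)
Lemma eval_agree k2 phi : forall (a A : pred var) m (G H : colored_graph)
    (e : var -> option G) (e' : var -> option H),
  admissible a phi -> (forall z, a z -> avail 1 k2 z) ->
  count (fun j => a (inr j)) (iota 0 k2) <= m ->
  (forall z, free z phi -> A z) ->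
  agree m.*2 A e e' ->
  agree m.*2.+1 (fun z => A z && (z != inl 0)) e e' ->
  eval e phi = eval e' phi.
Proof.
elim: phi => /=.
- by move=> x y a A m G H e e' _ _ _ hf h _; apply: (h (FEq x y)).
- by move=> x y a A m G H e e' _ _ _ hf h _; apply: (h (FEdge x y)).
- by move=> c x a A m G H e e' _ _ _ hf h _; apply: (h (FColor c x)).
- move=> p IH a A m G H e e' ha hs hc hf h1 h2.
  by rewrite (IH a A m G H e e').
- 1-4: by move=> p1 I1 p2 I2 a A m G H e e' /andP[a1 a2] hs hc hf h1 h2;
  rewrite (I1 a A m G H e e') ?(I2 a A m G H e e') // => z hz; apply: hf;
  rewrite hz ?orbT.
move=> q z p IH a A m G H e e' /andP[az hp] hs hc hf h1 h2.
pose A' w := A w || (w == z).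
have fA' w : free w p -> A' w.
  by rewrite /A'; case: eqP => [|/eqP n] fw; rewrite ?orbT ?hf // n.
have hs' w : spend a z w -> avail 1 k2 w by case/andP=> /hs.
have A'z : A' z by rewrite /A' eqxx orbT.
have [ez|[j ez]] : z = inl 0 \/ exists j, z = inr j.
  by move: (hs _ az); case: (z) => [[|//]|j] _; [left|right; exists j].
- subst z.
  have hc' : count (fun j => spend a (inl 0) (inr j)) (iota 0 k2) <= m.
    by rewrite (eq_count (a2 := fun j => a (inr j))) // => w; rewrite /spend orbT andbT.
  have sub w : (A w || (w == inl 0)) && (w != inl 0) -> A w && (w != inl 0).
    by case: (w == _); rewrite ?andbF ?orbF.
  (* Overwriting the x-variable keeps the agreement of rank [m.*2.+1] off it, while [agree_quant]
     provides rank [m.*2] on all variables. The graphs are arbitrary because [agree_quant] also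
     compares each graph with itself. *)
  have go (K L : colored_graph) (d : var -> option K) (d' : var -> option L) u v :
     agree m.*2.+1 (fun z => A z && (z != inl 0)) d d' ->
     agree m.*2 (fun w => A w || (w == inl 0)) (update d (inl 0) u) (update d' (inl 0) v) ->
     eval (update d (inl 0) u) p = eval (update d' (inl 0) v) p.
    move=> g1 g2; apply: IH hp hs' hc' fA' g2 _.
    by apply: agree_update; [rewrite eqxx andbF|apply: agree_mono g1].
  apply: (@agree_quant m.*2 (fun w => A w || (w == inl 0)) _ _ e e' (inl 0)) => //.
  + exact: agree_mono h2.
  + by move=> u v; apply: go => phi _.
  + by move=> u v; apply: go.
  + by move=> u v; apply: go => phi _.
(* One of the remaining y-variables is spent, so [m.+1] drops to [m]. The rank [m.+1.*2] drops to
   [m.*2.+1] on all variables, which covers both hypotheses for [m]. *)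
- subst z; have ltj : j < k2 := hs _ az.
  have [m0 hc'] := count_spend ltj az hc.
  case: m m0 hc' h1 {hc h2} => // m _ hc' h1.
  have go (K L : colored_graph) (d : var -> option K) (d' : var -> option L) u v :
     agree m.*2.+1 A' (update d (inr j) u) (update d' (inr j) v) ->
     eval (update d (inr j) u) p = eval (update d' (inr j) v) p.
    move=> g; apply: IH hp hs' hc' fA' _ _; first exact: agree_mono g.
    by apply: agree_mono g => // w /andP[].
  apply: (@agree_quant m.*2.+1 A' _ _ e e' (inr j)) => //.
  + apply: agree_mono h1 => //.
    by move=> w; rewrite /A'; case: (w == _); rewrite ?andbF ?orbF // andbT.
  + by move=> u v; apply: go.
  + by move=> u v; apply: go.
  + by move=> u v; apply: go.
Qed.

(** Each bound variable becomes the y-variable indexed by its quantifier depth, so nothing is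
    requantified and the rank bounds the number of variables. The map [s] records the depth at which
    each variable was last bound. *)
Fixpoint relevel (s : var -> nat) (j : nat) (phi : formula) : formula :=
  match phi with
  | FEq x y => FEq (inr (s x)) (inr (s y))
  | FEdge x y => FEdge (inr (s x)) (inr (s y))
  | FColor c x => FColor c (inr (s x))
  | FNot psi => FNot (relevel s j psi)
  | FAnd psi chi => FAnd (relevel s j psi) (relevel s j chi)
  | FOr psi chi => FOr (relevel s j psi) (relevel s j chi)
  | FImp psi chi => FImp (relevel s j psi) (relevel s j chi)
  | FIff psi chi => FIff (relevel s j psi) (relevel s j chi)
  | FQuant q x psi =>
      FQuant q (inr j) (relevel (fun z => if z == x then j else s z) j.+1 psi)
  end.

Lemma eval_relevel (G : colored_graph) phi s j (e e' : var -> option G) :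
  (forall z, free z phi -> s z < j /\ e' (inr (s z)) = e z) ->
  eval e' (relevel s j phi) = eval e phi.
Proof.
elim: phi s j e e' => /=.
- by move=> x y s j e e' h; rewrite !(h _ _).2 ?eqxx ?orbT.
- by move=> x y s j e e' h; rewrite !(h _ _).2 ?eqxx ?orbT.
- by move=> c x s j e e' h; rewrite !(h _ _).2 ?eqxx ?orbT.
- by move=> p IH s j e e' h; rewrite (IH s j e e').
- 1-4: by move=> p1 I1 p2 I2 s j e e' h; rewrite (I1 s j e e') ?(I2 s j e e') //
    => z hz; apply: h; rewrite hz ?orbT.
move=> q z p IH s j e e' h; apply: eq_eval_quant => v; apply: IH => w fw.
rewrite /update; case: (eqVneq w z) => [_|n]; first by rewrite eqxx.
have [lt ->] := h w (introT andP (conj n fw)); split; first exact: ltnW.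
by case: eqP => // -[E]; move: lt; rewrite E ltnn.
Qed.

Lemma free_relevel phi s j w :
  free w (relevel s j phi) -> exists2 z, free z phi & w = inr (s z).
Proof.
elim: phi s j => /=.
- by move=> x y s j /orP[] /eqP ->; [exists x|exists y]; rewrite ?eqxx ?orbT.
- by move=> x y s j /orP[] /eqP ->; [exists x|exists y]; rewrite ?eqxx ?orbT.
- by move=> _ x s j /eqP ->; exists x; rewrite ?eqxx ?orbT.
- by move=> p IH s j /IH.
- 1-4: by move=> p1 I1 p2 I2 s j /orP[/I1|/I2] [z fz ->]; exists z;
    rewrite ?fz ?orbT.
move=> q x p IH s j /andP[n /IH [z fz ew]]; move: n; rewrite ew.
by case: (eqVneq z x) => [_|nzx _]; [rewrite eqxx|exists z; rewrite // nzx].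
Qed.

Lemma admissible_relevel K phi s j :
  qrank phi + j <= K ->
  admissible (fun z => if z is inr i then j <= i < K else false)
    (relevel s j phi).
Proof.
elim: phi s j => //=.
- 1-4: by move=> p1 I1 p2 I2 s j h; rewrite I1 ?I2 //; lia.
move=> q z p IH s j h; apply/andP; split; first by lia.
apply: admissible_mono (IH _ j.+1 _); last by lia.
case=> // i /andP[ltj ltK]; rewrite /spend ltK ltnW //= orbF.
by apply/eqP => -[E]; move: ltj; rewrite E ltnn.
Qed.

(** By [relevel], graphs that the right-hand logic does not distinguish agree on all sentences of
    rank [k2'], and [k2' >= 2 * k2 + 1] is the rank that [eval_agree] asks for. *)
Lemma logic_le_one_x k2 k2' :
  k2.*2 < k2' -> logic_le (C_logic 1 k2) (C_logic 0 k2').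
Proof.
move=> lt G H /distinguishesP [phi [Ha Hs Hd]]; apply/distinguishesP.
apply: NNPP => nd; case/negP: Hd; apply/eqP.
have ag : agree k2' pred0 (fun=> @None G) (fun=> @None H).
  move=> p [rp fp]; apply: NNPP => ne; case: nd.
  have E K : holds K (relevel (fun=> 0) 0 p) = eval (fun=> @None K) p.
    by apply: eval_relevel => z /fp.
  exists (relevel (fun=> 0) 0 p); split.
  - apply: admissible_mono (admissible_relevel (K := k2') _ _); last by rewrite addn0.
    by case.
  - by move=> z; apply/negP => /free_relevel [w /fp].
  - by rewrite !E; apply/eqP.
apply: (@eval_agree k2 phi (avail 1 k2) pred0 k2) => //.
- by rewrite (leq_trans (count_size _ _)) ?size_iota.
- by move=> z; rewrite (negPf (Hs z)).
- by apply: agree_mono ag => //; apply: ltnW.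
- by apply: agree_mono ag.
Qed.

(** * Cai-Fürer-Immerman graphs and the robber *)

Section CFI.
Variables (V : finType) (adj : rel V) (key : V -> nat).
Hypotheses (adjC : symmetric adj) (adj_irr : irreflexive adj).

Notation vtx := (V * {ffun V -> bool})%type.

Definition parity (f : V -> bool) (v : V) : bool :=
  \big[addb/false]_(u | adj v u) f u.

Definition cfi_edge (p q : vtx) : bool :=
  adj p.1 q.1 && (p.2 q.1 == q.2 p.1).

Definition cfi_color (t : V -> bool) (p : vtx) : nat :=
  (key p.1).*2 + (parity p.2 p.1 (+) t p.1).

Lemma cfi_edge_sym : symmetric cfi_edge.
Proof. by move=> p q; rewrite /cfi_edge adjC eq_sym. Qed.

Lemma cfi_edge_irr : irreflexive cfi_edge.
Proof. by move=> p; rewrite /cfi_edge adj_irr. Qed.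

(* Unlike in the usual construction all 0/1-labelings [f] occur at [v], also on
   non-neighbors; whether the parity of [f] at [v] matches the twist [t v] is
   recorded in the color. *)
Definition cfi (t : V -> bool) : colored_graph :=
  @ColoredGraph (V * {ffun V -> bool})%type cfi_edge (cfi_color t)
    cfi_edge_sym cfi_edge_irr.

Definition flip (F : V -> V -> bool) (p : vtx) : vtx :=
  (p.1, [ffun u => p.2 u (+) F p.1 u]).

Lemma flipK F : involutive (flip F).
Proof.
case=> v f; rewrite /flip /=; congr (_, _); apply/ffunP => u.
by rewrite !ffunE -addbA addbb addbF.
Qed.

Lemma cfi_edge_flip F p q :
  (forall u v, F u v = F v u) -> cfi_edge (flip F p) (flip F q) = cfi_edge p q.
Proof.
move=> FC; rewrite /cfi_edge /= !ffunE FC.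
by case: (p.2 _); case: (q.2 _); case: (F _ _).
Qed.

Lemma parityD f g v :
  parity (fun u => f u (+) g u) v = parity f v (+) parity g v.
Proof. exact: big_split. Qed.

Lemma parity_delta v w : parity (fun u => u == w) v = adj v w.
Proof.
rewrite /parity; case: (boolP (adj v w)) => h.
  rewrite (bigD1 w) //= eqxx big1 ?addbF // => u /andP[_ /negPf].
  by [].
by rewrite big1 // => u hu; apply: contraNF h => /eqP <-.
Qed.

Lemma parity0 v : parity (fun=> false) v = false.
Proof. by rewrite /parity big1. Qed.

Lemma parity_flip F p :
  parity (flip F p).2 (flip F p).1 = parity p.2 p.1 (+) parity (F p.1) p.1.
Proof.
by rewrite -parityD; apply: eq_bigr => u _; rewrite ffunE.
Qed.

Inductive reach (X : V -> Prop) : V -> V -> Prop :=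
| ReachRefl r : reach X r r
| ReachStep r s r' :
    adj r s -> ~ X r -> ~ X s -> reach X s r' -> reach X r r'.

(* [F] is an isomorphism from the untwisted graph to the graph twisted at [v0],
   except that it is wrong about the color at [r]. *)
Definition flow (v0 r : V) (F : V -> V -> bool) : Prop :=
  (forall u v, F u v = F v u) /\
  (forall v, parity (F v) v = (v == v0) (+) (v == r)).

(** Toggling [F] on an edge from [r] to [s] moves the defect from [r] to [s] and changes [F] only at
    these two vertices, neither of which lies in [X]. *)
Lemma flow_reach v0 X r r' F :
  reach X r r' -> flow v0 r F ->
  exists2 F', flow v0 r' F' & forall v u, X v -> F' v u = F v u.
Proof.
move=> h; elim: h F => [{}r F hF|{}r s {}r' ars nr ns _ IH F [FC FP]].
  by exists F.
pose D v u := ((v == r) && (u == s)) (+) ((v == s) && (u == r)).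
have nrs : r != s by apply: contraTneq ars => ->; rewrite adj_irr.
have [|F' hF' eF'] := IH (fun v u => F v u (+) D v u).
  split=> [u v|v]; first by rewrite FC /D addbC [(v == r) && _]andbC
    [(v == s) && _]andbC [X in X (+) _]addbC addbC.
  rewrite parityD FP -addbA; congr (_ (+) _).
  rewrite /D parityD.
  have pa b w : parity (fun u => b && (u == w)) v = b && adj v w.
    by case: b => /=; rewrite ?parity0 ?parity_delta.
  rewrite !pa; case: (eqVneq v r) => [->|nvr].
    by rewrite (negPf nrs) ars.
  by case: eqP => [->|//]; rewrite adjC ars.
exists F' => // v u Xv; rewrite eF' // /D.
have /negPf -> : v != r by apply/eqP => e; apply: nr; rewrite -e.
have /negPf -> : v != s by apply/eqP => e; apply: ns; rewrite -e.
by rewrite addbF.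
Qed.

Definition others (D : var -> option V) (z : var) (v : V) : Prop :=
  exists2 w, w != z & D w = Some v.

(* [I D a r] says that the robber, standing on [r], can escape for ever when
   the cops stand at [D] and those in [a] may still be placed. *)
Definition escape (I : (var -> option V) -> pred var -> V -> Prop) : Prop :=
  (forall D a r, I D a r -> forall z, D z <> Some r) /\
  (forall D a r z v, I D a r -> a z ->
     exists2 r', reach (others D z) r r' & I (update D z v) (spend a z) r').

Lemma card_comp_inv (T : finType) (f : T -> T) (P : pred T) :
  involutive f -> #|[pred x | P (f x)]| = #|P|.
Proof.
move=> fK; rewrite -[LHS](card_image (inv_inj fK)); apply: eq_card => x.
apply/imageP/idP => [[y]|Px]; first by rewrite inE => Py ->.
by exists (f x); rewrite ?inE fK.
Qed.

(** The assignments correspond under [flip F], whose only defect is at the robber's vertex. No cop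
    stands there, so atoms agree. At a quantifier, the robber's answers to all possible placements
    are combined into one bijection between the graphs. *)
Lemma cfi_eval I v0 phi : escape I ->
  forall D a r F (e : var -> option (cfi (fun=> false)))
    (e' : var -> option (cfi (pred1 v0))),
  admissible a phi -> I D a r -> flow v0 r F ->
  (forall z, D z = omap fst (e z)) ->
  (forall z, e' z = omap (flip F) (e z)) ->
  eval e phi = eval e' phi.
Proof.
case=> Ifree Istep; elim: phi => /=.
- move=> x y D a r F e e' _ _ _ _ he; rewrite !he.
  case: (e x) (e y) => [p|] [q|] //=.
  by rewrite -(inj_eq (inv_inj (flipK F))).
- move=> x y D a r F e e' _ _ [FC _] _ he; rewrite !he.
  by case: (e x) (e y) => [p|] [q|] //=; rewrite cfi_edge_flip.
- move=> c x D a r F e e' _ hI [_ FP] hD he; rewrite !he.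
  have := Ifree _ _ _ hI x; rewrite hD.
  case: (e x) => [p|] //= nr; rewrite /cfi_color parity_flip FP /=.
  have /negPf -> : p.1 != r by apply/eqP => e1; apply: nr; rewrite e1.
  by rewrite !addbF -addbA addbb addbF.
- by move=> p IH D a r F e e' ha hI hF hD he; rewrite (IH D a r F e e').
- 1-4: by move=> p1 I1 p2 I2 D a r F e e' /andP[a1 a2] hI hF hD he;
    rewrite (I1 D a r F e e') ?(I2 D a r F e e').
move=> q z p IH D a r F e e' /andP[az hp] hI hF hD he.
have step v : exists rF : V * {ffun V * V -> bool},
    [/\ I (update D z v) (spend a z) rF.1,
        flow v0 rF.1 (fun u w => rF.2 (u, w))
      & forall u w, others D z u -> rF.2 (u, w) = F u w].
  have [r' hr hI'] := Istep _ _ _ z v hI az.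
  have [F' [FC FP] eF'] := flow_reach hr hF.
  exists (r', [ffun uw => F' uw.1 uw.2]); split=> //=.
    split=> [u w|w]; first by rewrite !ffunE.
    by rewrite -FP; apply: eq_bigr => u _; rewrite ffunE.
  by move=> u w hu; rewrite ffunE eF'.
have [R HR] := fin_all_exists step.
(* The robber's answer depends only on the base vertex [x.1], which flipping preserves; hence [g] is
   an involution although a different flow is used over each base vertex. *)
pose g (x : vtx) : vtx := flip (fun u w => (R x.1).2 (u, w)) x.
have gK : involutive g by move=> x; rewrite {1}/g /= flipK.
have E (x : vtx) : @eval (cfi (fun=> false)) (update e z x) p
                 = @eval (cfi (pred1 v0)) (update e' z (g x)) p.
  have [h1 h2 h3] := HR x.1.
  apply: (IH _ _ _ _ _ _ hp h1 h2) => w; rewrite /update; case: eqP => // /eqP n.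
  rewrite he; case Ee: (e w) => [y|] //=; congr Some.
  rewrite /flip; congr (_, _); apply/ffunP => u; rewrite !ffunE h3 //.
  by exists w; rewrite // hD Ee.
pose P (x : vtx) := @eval (cfi (fun=> false)) (update e z x) p.
pose Q (x : vtx) := @eval (cfi (pred1 v0)) (update e' z x) p.
rewrite -/P -/Q; apply: eval_quant_card.
- by rewrite -(card_comp_inv Q gK); apply: eq_card => x; rewrite !inE; apply: E.
- rewrite -(card_comp_inv (predC Q) gK); apply: eq_card => x.
  by rewrite !inE /= /in_mem /= /P E.
Qed.

Lemma cfi_indist I v0 k1 k2 : escape I ->
  I (fun=> None) (avail k1 k2) v0 ->
  ~ distinguishes (C_logic k1 k2) (cfi (fun=> false)) (cfi (pred1 v0)).
Proof.
move=> Iesc I0 /distinguishesP [phi [ha _ /eqP]]; apply.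
apply: (cfi_eval Iesc (D := fun=> None) (F := fun _ _ => false) ha I0) => //.
by split=> // v; rewrite parity0 /= addbb.
Qed.

Lemma reach_sym X r r' : reach X r r' -> reach X r' r.
Proof.
elim=> [{}r|{}r s {}r' ars nr ns _ h]; first exact: ReachRefl.
elim: h (ars) ns => [u aru nu|u v w auv nu nv _ IH asr nw].
  by apply: ReachStep (ReachRefl _ _) => //; rewrite adjC.
by apply: ReachStep auv nu nv _; apply: IH.
Qed.

End CFI.

(** Each edge is counted once from either end; the order [lt] on the vertices splits the sum into
    two equal halves, which cancel. *)
Lemma addb_double_sum (V : finType) (adj : rel V) (M : V -> V -> bool) :
  symmetric adj -> (forall u v, adj u v -> M u v = M v u) ->
  irreflexive adj ->
  \big[addb/false]_v \big[addb/false]_(u | adj v u) M v u = false.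
Proof.
move=> adjC MC adjI.
pose lt (u v : V) := enum_rank u < enum_rank v.
pose S := \big[addb/false]_v \big[addb/false]_(u | adj v u && lt v u) M v u.
rewrite -[RHS](addbb S); under eq_bigr => v _ do
  rewrite (bigID (lt v)) /=.
rewrite big_split /=; congr (_ (+) _).
rewrite /S [RHS](exchange_big_dep xpredT) //=.
apply: eq_bigr => v _; apply: eq_big => [u|u /andP[a _]]; last exact: MC.
rewrite adjC /lt; case: (boolP (adj u v)) => //= a.
rewrite -leqNgt leq_eqVlt; case: eqP => // /val_inj/enum_rank_inj e.
by move: a; rewrite e adjI.
Qed.

(** * The base graphs *)

Section Tree.
Variables H h : nat.

Notation V := {bseq H of bool}.

(** A node is the string of turns leading to it from the root, the latest turn first: ancestors are
    suffixes, children arise by consing, and the size is the depth. *)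
Definition anc (u v : seq bool) : bool :=
  [&& size v < size u, size u <= size v + h & suffix v u].

Definition tree_adj (u v : V) : bool := anc u v || anc v u.

Lemma tree_adjC : symmetric tree_adj.
Proof. by move=> u v; rewrite /tree_adj orbC. Qed.

Lemma tree_adj_irr : irreflexive tree_adj.
Proof. by move=> u; rewrite /tree_adj /anc ltnn. Qed.

(** Strings longer than [H] are sent to the root. *)
Definition node (s : seq bool) : V := insubd [bseq] s.

Lemma nodeK s : size s <= H -> node s = s :> seq bool.
Proof. by move=> hs; rewrite /node val_insubd hs. Qed.

Definition tree_key (v : V) : nat := pickle (v : seq bool).

Definition tree_cfi (t : V -> bool) : colored_graph :=
  cfi tree_key tree_adjC tree_adj_irr t.

(** * The homomorphism sentence *)

Variable c : nat -> var.
Hypothesis c_inj : forall i j, i < j -> j <= i + h -> c i != c j.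

(** The variable [c i] holds the image of the current ancestor at depth [i], and [c_inj] keeps the
    last [h] of them available. The even color demands that the parity match the twist; [FEq z z]
    stands for truth. *)
Fixpoint hom_formula (n : nat) (s : seq bool) : formula :=
  let z := c (size s) in
  FQuant Exists z (FAnd (FColor (pickle s).*2 z)
    (FAnd (foldr FAnd (FEq z z)
             [seq FEdge z (c i) | i <- iota 0 (size s) & size s <= i + h])
          (if n is n'.+1
           then FAnd (hom_formula n' (true :: s)) (hom_formula n' (false :: s))
           else FEq z z))).

Lemma eval_conj (G : colored_graph) (e : var -> option G) b l :
  eval e (foldr FAnd b l) = all (eval e) l && eval e b.
Proof. by elim: l => //= p l ->; rewrite andbA. Qed.

Lemma free_conj z b l :
  free z (foldr FAnd b l) = has (free z) l || free z b.
Proof. by elim: l => //= p l ->; rewrite orbA. Qed.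

Lemma admissible_conj a b l :
  admissible a (foldr FAnd b l) = all (admissible a) l && admissible a b.
Proof. by elim: l => //= p l ->; rewrite andbA. Qed.

Lemma free_hom_formula n s z :
  free z (hom_formula n s) -> exists2 i, i < size s & z = c i.
Proof.
have edges (r : seq bool) : z != c (size r) -> has (free z)
    [seq FEdge (c (size r)) (c i) | i <- iota 0 (size r) & size r <= i + h] ->
    exists2 i, i < size r & z = c i.
  move=> nz; rewrite has_map => /hasP [i]; rewrite mem_filter mem_iota => /andP[_ il] /=.
  by rewrite (negPf nz) => /eqP ->; exists i.
elim: n s => [|n IH] s /= /andP[nz];
  rewrite free_conj /= (negPf nz) /= ?orbF; first exact: edges nz.
case/orP => [/(edges _ nz)|] //.
by case/orP => /IH [i]; rewrite /= ltnS leq_eqVlt => /orP[/eqP ->|lt] e;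
  (try by exists i); move: nz; rewrite e eqxx.
Qed.

Lemma admissible_hom_formula n s (a : pred var) :
  (forall i, size s <= i <= size s + n -> a (c i)) ->
  (forall i j, size s <= i -> i < j -> j <= size s + n ->
     is_x (c i) || (c j != c i)) ->
  admissible a (hom_formula n s).
Proof.
elim: n s a => [|n IH] s a ha hx /=; rewrite ha ?leqnn ?leq_addr //=;
  rewrite admissible_conj all_map /= !andbT; first by apply/allP.
apply/andP; split; first by apply/allP.
apply/andP; split; apply: IH => /= [i hi|i j h1 h2 h3]; try by apply: hx; lia.
all: by apply/andP; split; [apply: ha; lia|rewrite orbC hx //; lia].
Qed.

Lemma drop_anc k s : 0 < k <= size s -> k <= h -> anc s (drop k s).
Proof.
move=> /andP[k0 ks] kh; rewrite /anc size_drop suffix_drop andbT; lia.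
Qed.

Lemma eval_hom_formula (G : colored_graph) n s (e : var -> option G) :
  eval e (hom_formula n s) = [exists p : G,
    let e' := update e (c (size s)) p in
    [&& color p == (pickle s).*2,
        all (fun i => if e' (c i) is Some q then edge p q else false)
          [seq i <- iota 0 (size s) | size s <= i + h]
      & if n is n'.+1 then eval e' (hom_formula n' (true :: s)) &&
          eval e' (hom_formula n' (false :: s)) else true]].
Proof.
have evalQ z (f g k : formula) : eval e (FQuant Exists z (FAnd f (FAnd g k))) =
    [exists p : G, [&& eval (update e z p) f, eval (update e z p) g
                     & eval (update e z p) k]] by [].
have -> : hom_formula n s = FQuant Exists (c (size s))
    (FAnd (FColor (pickle s).*2 (c (size s)))
    (FAnd (foldr FAnd (FEq (c (size s)) (c (size s)))
             [seq FEdge (c (size s)) (c i) |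
                i <- iota 0 (size s) & size s <= i + h])
          (if n is n'.+1
           then FAnd (hom_formula n' (true :: s)) (hom_formula n' (false :: s))
           else FEq (c (size s)) (c (size s))))) by case: n.
rewrite evalQ; apply: eq_existsb => p; rewrite eval_conj all_map.
have cz : update e (c (size s)) p (c (size s)) = Some p by rewrite /update eqxx.
rewrite [eval _ (FColor _ _)]/= [eval _ (FEq _ _)]/= cz eqxx andbT.
congr [&& _, _ & _]; last by case: n => [|n] //=; rewrite cz eqxx.
by apply: eq_all => i /=; rewrite cz.
Qed.

Lemma c_update (T : Type) (e : var -> option T) (s : seq bool) i p :
  i < size s -> size s <= i + h -> update e (c (size s)) p (c i) = e (c i).
Proof. by move=> h1 h2; rewrite /update (negPf (c_inj h1 h2)). Qed.

(** Here [W] maps strings to graph vertices, and [drop (size s - i) s] is the ancestor of [s] at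
    depth [i]. Storing the image of [s] overwrites no ancestor that the child still needs. *)
Lemma window_child (T : Type) (e : var -> option T) (W : seq bool -> T) s b p :
  W s = p ->
  (forall i, i < size s -> size s <= i + h ->
     e (c i) = Some (W (drop (size s - i) s))) ->
  forall i, i < size (b :: s) -> size (b :: s) <= i + h ->
    update e (c (size s)) p (c i) = Some (W (drop (size (b :: s) - i) (b :: s))).
Proof.
move=> Ws he i /=; rewrite ltnS leq_eqVlt => /orP[/eqP ->|lt] hi.
  by rewrite subSnn /= drop0 /update eqxx Ws.
by rewrite c_update ?he ?subSn //; lia.
Qed.

(** Every node is mapped to itself with the zero labeling: its parity is even, and labels agree
    along all edges. *)
Lemma hom_formula_true n s (e : var -> option (tree_cfi (fun=> false))) :
  size s + n <= H ->
  (forall i, i < size s -> size s <= i + h ->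
     e (c i) = Some (node (drop (size s - i) s), [ffun=> false])) ->
  eval e (hom_formula n s).
Proof.
elim: n s e => [|n IH] s e hs he; rewrite eval_hom_formula; apply/existsP;
  exists (node s, [ffun=> false]) => /=.
all: set e' := update _ _ _.
all: apply/and3P; split.
all: try (rewrite /cfi_color /tree_key /= nodeK; last by lia).
all: try (rewrite /parity big1 /= ?addn0 // => u _; by rewrite ffunE).
all: try (apply/allP => i; rewrite mem_filter mem_iota => /andP[h1 /andP[_ h2]];
  rewrite /e' c_update // he //= /cfi_edge /= !ffunE eqxx andbT /tree_adj;
  rewrite !nodeK ?size_drop ?drop_anc //; lia).
- by [].
- apply/andP; split; apply: IH; rewrite /= ?addSnnS // => i h1 h2.
  + exact: (window_child (W := fun u => (node u, [ffun=> false]))).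
  + exact: (window_child (W := fun u => (node u, [ffun=> false]))).
Qed.

Definition tree_good (t : V -> bool) (W : seq bool -> tree_cfi t) (u : seq bool) :=
  [/\ (W u).1 = u :> seq bool, parity tree_adj (W u).2 (W u).1 = t (W u).1
    & forall k, 0 < k <= size u -> k <= h -> edge (W u) (W (drop k u))].

Lemma suffix_same (s s' u : seq bool) :
  size s = size s' -> suffix s u -> suffix s' u -> s = s'.
Proof. by rewrite !suffixE => -> /eqP {1}<- /eqP. Qed.

Lemma suffix_childE n (s u : seq bool) :
  suffix s u -> size u <= size s + n.+1 ->
  u = s \/ exists2 b, suffix (b :: s) u & size u <= size (b :: s) + n.
Proof.
case/suffixP => r; case/lastP: r => [|r b] -> hs; first by left.
right; exists b; first by rewrite cat_rcons suffix_suffix.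
by move: hs; rewrite !size_cat size_rcons /=; lia.
Qed.

Lemma tree_good_window t (s : seq bool) (e : var -> option (tree_cfi t)) W p :
  color p = (pickle s).*2 -> W s = p ->
  all (fun i => if update e (c (size s)) p (c i) is Some q
                then edge p q else false)
    [seq i <- iota 0 (size s) | size s <= i + h] ->
  (forall i, i < size s -> size s <= i + h ->
     e (c i) = Some (W (drop (size s - i) s))) ->
  tree_good W s.
Proof.
move=> hcol Ws /allP hedge he; split; rewrite ?Ws.
- apply/(pcan_inj pickleK); move: hcol; rewrite /= /cfi_color /tree_key.
  by case: (_ (+) _) => /=; lia.
- move: hcol; rewrite /= /cfi_color.
  by case: (parity _ _ _); case: (t _) => //=; lia.
- move=> k hk hkh; have /hedge : size s - k \in
      [seq i <- iota 0 (size s) | size s <= i + h].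
    by rewrite mem_filter mem_iota; lia.
  have l1 : size s - k < size s by lia.
  have l2 : size s <= size s - k + h by lia.
  by rewrite c_update // he // subKn //; lia.
Qed.

(** The witnesses are glued: [W0] is overwritten at [s], then on the subtree of [true :: s], then on
    that of [false :: s]. Since [tree_good] looks only at a node and its ancestors, and none of
    these lies in the sibling subtree, later changes spoil nothing. *)
Lemma hom_formula_hom t n (s : seq bool) (e : var -> option (tree_cfi t)) W0 :
  eval e (hom_formula n s) ->
  (forall i, i < size s -> size s <= i + h ->
     e (c i) = Some (W0 (drop (size s - i) s))) ->
  exists2 W : seq bool -> tree_cfi t,
    forall u : seq bool, ~~ suffix s u -> W u = W0 u &
    forall u : seq bool, suffix s u -> size u <= size s + n -> tree_good W u.
Proof.
elim: n s e W0 => [|n IH] s e W0; rewrite eval_hom_formula => /existsP[p];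
  move=> /and3P[/eqP hcol hedge hch] he.
all: pose W1 (u : seq bool) := if u == s then p else W0 u.
all: have W1n u : ~~ suffix s u -> W1 u = W0 u
  by rewrite /W1; case: eqP => // ->; rewrite suffix_refl.
all: have W1d k : 0 < k <= size s -> W1 (drop k s) = W0 (drop k s)
  by move=> hk; rewrite /W1; case: eqP => // /(congr1 (@size bool)) E;
     exfalso; move: E; rewrite size_drop; lia.
all: have good_s W (Ws : W s = p)
    (Wd : forall k, 0 < k <= size s -> W (drop k s) = W0 (drop k s)) :
  tree_good W s
  by apply: (tree_good_window hcol Ws hedge) => i h1 h2; rewrite Wd ?he //; lia.
- exists W1 => // u sf hu; suff -> : u = s.
    by apply: good_s => //; rewrite /W1 eqxx.
  apply/eqP; rewrite eq_sym; move: sf; rewrite suffixE => /eqP <-.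
  by rewrite (_ : size u - size s = 0) ?drop0 //; lia.
case/andP: hch => ch1 ch2.
have W1s : W1 s = p by rewrite /W1 eqxx.
have he1 i : i < size s -> size s <= i + h ->
    e (c i) = Some (W1 (drop (size s - i) s)).
  by move=> h1 h2; rewrite W1d ?he //; lia.
have nsuf b k : ~~ suffix (b :: s) (drop k s).
  by apply/negP => /size_suffix /=; rewrite size_drop; lia.
have [W2 W2n W2g] := IH _ _ _ ch1 (window_child (b := true) W1s he1).
have W2d k : W2 (drop k s) = W1 (drop k s) by rewrite W2n.
have W2s : W2 s = p by have := W2d 0; rewrite drop0 => ->.
have he2 i : i < size s -> size s <= i + h ->
    e (c i) = Some (W2 (drop (size s - i) s)).
  by move=> h1 h2; rewrite W2d he1.
have [W3 W3n W3g] := IH _ _ _ ch2 (window_child (b := false) W2s he2).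
have W3d k : W3 (drop k s) = W1 (drop k s) by rewrite W3n.
exists W3 => [u nu|u su hu].
  have nb b : ~~ suffix (b :: s) u.
    by apply: contra nu; apply: suffix_trans; apply: suffix_cons.
  by rewrite W3n // W2n // W1n.
case: (suffix_childE su hu) => [->|[[] sb hb]]; last exact: W3g.
- apply: good_s => [|k hk]; first by have := W3d 0; rewrite drop0 => ->.
  by rewrite W3d W1d.
- have nf k : ~~ suffix (false :: s) (drop k u).
    apply/negP => /(suffix_trans) /(_ (suffix_drop u k)) sf.
    by have := suffix_same _ sb sf => /(_ erefl).
  have [g1 g2 g3] := W2g u sb hb.
  have e0 : W3 u = W2 u by have := nf 0; rewrite drop0 => /W3n.
  split; rewrite ?e0 // => k hk hkh; rewrite W3n //; exact: g3.
Qed.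

(** In the twisted graph a homomorphism would yield labels that agree along all edges, so the
    parities would sum to zero by double counting; but they are odd at [v0] only. *)
Lemma tree_cfi_dist k1 k2 v0 :
  (forall i, i <= H -> avail k1 k2 (c i)) ->
  (forall i j, i < j <= H -> is_x (c i) || (c j != c i)) ->
  distinguishes (C_logic k1 k2) (tree_cfi (fun=> false)) (tree_cfi (pred1 v0)).
Proof.
move=> hav hx; apply/distinguishesP; exists (hom_formula H [::]); split.
- by apply: admissible_hom_formula => /= [i|i j _ h1 h2]; rewrite ?add0n;
    [exact: hav|apply: hx; rewrite h1].
- by move=> z; apply/negP => /free_hom_formula [].
rewrite {1}/holds hom_formula_true //= eq_sym.
apply/negP => /eqP hf.
(* The initial [W0] is a dummy, as the root has no ancestors. *)
have [|W _ Wg] := hom_formula_hom (W0 := fun=> (v0, [ffun=> false])) hf.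
  by [].
have good (v : V) : tree_good W v by apply: Wg; [exact: suffix0s|exact: size_bseq].
have W1 (v : V) : (W v).1 = v by apply: val_inj; have [] := good v.
have := @addb_double_sum V tree_adj (fun v u => (W v).2 u) tree_adjC _ tree_adj_irr.
have edgeW (u v : V) : anc u v -> (W u).2 v = (W v).2 u.
  move=> /and3P[h1 h2 h3]; have [_ _ /(_ (size u - size v))] := good u.
  move: h3; rewrite suffixE => /eqP ->.
  have a1 : 0 < size u - size v <= size u by lia.
  have a2 : size u - size v <= h by lia.
  by move=> /(_ a1 a2) /andP[_ /eqP]; rewrite !W1.
rewrite (eq_bigr (fun v => v == v0)) => [|v _].
  rewrite (bigD1 v0) //= eqxx big1 => [|v /negPf //].
  move=> /(_ _) hh; suff : true = false by [].
  by apply: hh => u v /orP[/edgeW|/edgeW].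
by have [_ g _] := good v; move: g; rewrite W1.
Qed.
End Tree.

(** * Robber strategies *)

Lemma exists_notin (T : eqType) (l m : seq T) :
  uniq l -> size m < size l -> exists2 x, x \in l & x \notin m.
Proof.
move=> ul lt; apply/allPn; apply: contraL lt => /allP sub.
by rewrite -leqNgt uniq_leq_size.
Qed.

Section Spine.
Variables H h : nat.
Notation V := {bseq H of bool}.

Definition spine (i : nat) : V := node H (nseq i true).

Lemma spineE i : i <= H -> spine i = nseq i true :> seq bool.
Proof. by move=> hi; rewrite nodeK // size_nseq. Qed.

Lemma spine_inj i j : i <= H -> j <= H -> spine i = spine j -> i = j.
Proof.
move=> hi hj /(congr1 (fun v : V => size v)); by rewrite !spineE // !size_nseq.
Qed.

Lemma spine_adj i j :
  i <= H -> j <= H -> i < j <= i + h -> tree_adj h (spine i) (spine j).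
Proof.
move=> hi hj /andP[lt le]; apply/orP; right.
rewrite /anc !spineE // !size_nseq lt le /=.
by apply/suffixP; exists (nseq (j - i) true); rewrite -nseqD subnK // ltnW.
Qed.

(* Each of [i+1 .. i+h] is within reach from [i], and one of them is free. *)
Lemma reach_spine_up (X : V -> Prop) (m : seq nat) A B i j :
  size m < h -> B <= H.+1 ->
  (forall k, A <= k < B -> X (spine k) -> k \in m) ->
  A <= i -> i <= j -> j < B -> ~ X (spine i) -> ~ X (spine j) ->
  reach (tree_adj (H := H) h) X (spine i) (spine j).
Proof.
move=> hm hB hX.
have [n] := ubnP (j - i); elim: n i => // n IH i lt Ai ij jB ni nj.
have [->|nij] := eqVneq i j; first exact: ReachRefl.
have [le|gt] := leqP j (i + h).
  by apply: ReachStep (ReachRefl _ _ _) => //; apply: spine_adj; lia.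
have [|k] := @exists_notin _ (iota i.+1 h) m (iota_uniq _ _).
  by rewrite size_iota.
rewrite mem_iota => hk km.
have nk : ~ X (spine k) by move=> Xk; move/negP: km; apply; apply: hX Xk; lia.
apply: (@ReachStep _ _ _ _ (spine k)) => //; first by apply: spine_adj; lia.
by apply: IH; lia || assumption.
Qed.

Lemma reach_spine (X : V -> Prop) (m : seq nat) A B i j :
  size m < h -> B <= H.+1 ->
  (forall k, A <= k < B -> X (spine k) -> k \in m) ->
  A <= i < B -> A <= j < B -> ~ X (spine i) -> ~ X (spine j) ->
  reach (tree_adj (H := H) h) X (spine i) (spine j).
Proof.
move=> hm hB hX hi hj ni nj; have [le|lt] := leqP i j.
  by apply: (reach_spine_up hm hB hX) => //; lia.
apply: reach_sym; first exact: tree_adjC.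
by apply: (reach_spine_up hm hB hX) => //; lia.
Qed.

End Spine.

Lemma not_logic_le_dist L L' G H :
  distinguishes L G H -> ~ distinguishes L' G H -> ~ logic_le L L'.
Proof. by move=> d nd le; apply: nd; apply: le. Qed.

Definition avail_seq (k1 k2 : nat) : seq var :=
  [seq xvar i | i <- iota 0 k1] ++ [seq yvar j | j <- iota 0 k2].

Lemma mem_avail_seq k1 k2 z : avail k1 k2 z -> z \in avail_seq k1 k2.
Proof.
rewrite mem_cat; case: z => i hi; apply/orP; [left|right];
  by apply/mapP; exists i; rewrite ?mem_iota.
Qed.

Lemma not_logic_le_total k1 k2 k1' k2' :
  k1' + k2' < k1 + k2 -> ~ logic_le (C_logic k1 k2) (C_logic k1' k2').
Proof.
move=> lt; pose H := (k1 + k2).-1.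
(* Each of the [H.+1 = k1 + k2] levels gets a variable of its own. *)
pose c i : var := if i < k1 then inl i else inr (i - k1).
have cI i j : i < j -> c i != c j.
  move=> ij; rewrite /c; case: ltnP => h1; case: ltnP => h2 //; try lia;
    by apply/eqP => -[]; lia.
apply: (@not_logic_le_dist _ _ (tree_cfi H.+1 (fun=> false))
          (tree_cfi H.+1 (pred1 (spine H 0)))).
  apply: (@tree_cfi_dist H H.+1 c) => [i j ij _|i hi|i j /andP[ij _]].
  - exact: cI.
  - by rewrite /c; case: ltnP => ? /=; lia.
  - by rewrite eq_sym cI ?orbT.
pose I (D : var -> option {bseq H of bool}) (a : pred var) r :=
  [/\ exists2 i, i <= H & r = spine H i, forall z, D z <> Some r,
      forall z, D z <> None -> avail k1' k2' z
    & forall z, a z -> avail k1' k2' z].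
apply: (@cfi_indist _ _ _ _ _ I); last by split=> //; exists 0.
split=> [D a r []//|D a r z v [[i hi ->] nD hD ha] az].
pose D' := update D z v.
have hD' w : D' w <> None -> avail k1' k2' w.
  by rewrite /D' /update; case: eqP => [->|_]; [move=> _; exact: ha|exact: hD].
(* Some spine node is free after the move. Only the cop [z] can have left it, and the spine is a
   clique, so the robber gets there in at most one step. *)
have [||u] := @exists_notin _ [seq spine H i | i <- iota 0 H.+1]
  (pmap D' (avail_seq k1' k2')).
- rewrite map_inj_in_uniq ?iota_uniq // => p q; rewrite !mem_iota => hp hq.
  by apply: spine_inj; lia.
- rewrite size_map size_iota size_pmap.
  apply: leq_ltn_trans (count_size _ _) _.
  by rewrite size_cat !size_map !size_iota /H; lia.
case/mapP => j; rewrite mem_iota => hj -> {u} nj.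
have nj' w : D' w <> Some (spine H j).
  move=> e; move/negP: nj; apply; rewrite mem_pmap; apply/mapP; exists w => //.
  by apply: mem_avail_seq; apply: hD'; rewrite e.
exists (spine H j); last first.
  split=> //; [by exists j; rewrite // -ltnS|].
  by move=> w /andP[/ha].
have no w : others D z w -> w <> spine H i /\ w <> spine H j.
  case=> x nx e; split=> ew; first by apply: (nD x); rewrite e ew.
  by apply: (nj' x); rewrite /D' /update (negPf nx) e ew.
have [->|nij] := eqVneq i j; first exact: ReachRefl.
apply: ReachStep (ReachRefl _ _ _); try by move=> /no [].
have [ij|ji] := ltnP i j; first by apply: spine_adj; lia.
by rewrite tree_adjC; apply: spine_adj; lia.
Qed.

(* The robber keeps an interval of the spine free of y-cops, cut into [h+1]
   blocks, and stands in a block free of all cops. Lifting an x-cop leaves at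
   most [h-1] of them, which do not disconnect the interval; a new y-cop leaves
   one half of the robber's block as the next interval. *)
Lemma not_logic_le_requant k1 k2 k1' k2' :
  1 < k1 -> k1' < k1 -> ~ logic_le (C_logic k1 k2) (C_logic k1' k2').
Proof.
move=> k1_gt1 lt; pose h := k1.-1.
(* [S m] is the block length while [m] y-cops are left: half a block of length [S m.+1] is an
   interval of [h.+1] blocks of length [S m]. *)
have [S S0 SS] : exists2 S : nat -> nat,
    (forall m, 0 < S m) & (forall m, S m.+1 = 2 * (h.+1 * S m)).
  exists (fun m => (2 * h.+1) ^ m) => m; first by rewrite expn_gt0.
  by rewrite expnS mulnA.
pose H := (h.+1 * S k2').-1.
have H1 : H.+1 = h.+1 * S k2' by rewrite prednK // muln_gt0 S0.
(* The [h.+1 = k1] x-variables are reused cyclically down the tree. *)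
pose c i : var := inl (i %% h.+1).
apply: (@not_logic_le_dist _ _ (tree_cfi h (fun=> false))
          (tree_cfi h (pred1 (spine H 0)))).
  apply: (@tree_cfi_dist H h c) => [i j ij le|i hi|//].
  - apply/eqP => -[] /eqP; rewrite eq_sym eqn_mod_dvd; last exact: ltnW.
    by move/dvdn_leq; lia.
  - by rewrite /= -[X in _ < X](ltn_predK k1_gt1) ltn_mod.
(* The interval starts at depth [A], and the robber stands in its block number [j]; [m] bounds the
   number of y-cops not yet placed. *)
pose I (D : var -> option {bseq H of bool}) (a : pred var) r :=
  exists m A j,
  [/\ A + h.+1 * S m <= H.+1, j <= h
    & count (fun i => a (inr i)) (iota 0 k2') <= m] /\
  [/\ forall l i, A <= i < A + h.+1 * S m -> D (inr l) <> Some (spine H i),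
      forall w i, A + j * S m <= i < A + j * S m + S m ->
        D w <> Some (spine H i),
      exists2 i, A + j * S m <= i < A + j * S m + S m & r = spine H i,
      forall w, D w <> None -> avail k1' k2' w
    & forall w, a w -> avail k1' k2' w].
apply: (@cfi_indist _ _ _ _ _ I); last first.
  exists k2', 0, 0; split; split=> //; first by rewrite H1.
    by rewrite (leq_trans (count_size _ _)) ?size_iota.
  by exists 0 => //=; rewrite !mul0n !add0n.
split=> [D a r [m [A [j [_ [_ nJ [i hi ->] _ _]]]]] z|]; first exact: nJ.
move=> D a r z v [m [A [j [[hA hj hc] [nI nJ [i hi ->] hD ha]]]]] az.
have hD' w : update D z v w <> None -> avail k1' k2' w.
  by rewrite /update; case: eqP => [->|_]; [move=> _; exact: ha|exact: hD].
have ha' w : spend a z w -> avail k1' k2' w by case/andP => /ha.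
have block k : k <= h -> k * S m + S m <= h.+1 * S m.
  by move=> hk; rewrite -mulSnr leq_mul2r ltnS hk orbT.
have bj := block j hj.
have sz k : k <= H -> size (spine H k) = k.
  by move=> hk; rewrite spineE // size_nseq.
case: z az hD' ha' => l az hD' ha'.
- have lk : l < k1' := ha _ az.
  (* The block occupied by the x-cop [q] after the move. A cop outside the interval or off the spine
     may mark a block needlessly, but at most [k1'] of the [h.+1] blocks get marked. *)
  pose b q := omap (fun v : {bseq H of bool} => (size v - A) %/ S m)
    (update D (inl l) v (inl q)).
  have [||k] := @exists_notin _ (iota 0 h.+1) (pmap b (iota 0 k1')).
  + exact: iota_uniq.
  + rewrite size_pmap size_iota; apply: leq_ltn_trans (count_size _ _) _.
    by rewrite size_iota /h; lia.
  rewrite mem_iota ltnS => /= hk nk.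
  have bk := block k hk.
  have nK w i' : A + k * S m <= i' < A + k * S m + S m ->
      update D (inl l) v w <> Some (spine H i').
    move=> hi' e; case: w e => [q|q] e; last first.
      by apply: (nI q i') => //; lia.
    have hq : q < k1' by apply: (hD' (inl q)); rewrite e.
    move/negP: nk; apply; rewrite mem_pmap; apply/mapP; exists q.
      by rewrite mem_iota.
    rewrite /b e /= sz; last by lia.
    have -> : i' - A = k * S m + (i' - A - k * S m) by lia.
    by rewrite divnMDl ?S0 // divn_small ?addn0 //; lia.
  exists (spine H (A + k * S m)); last first.
    exists m, A, k; split; split=> //.
    + by rewrite (eq_count (a2 := fun j => a (inr j))) // => w;
        rewrite /spend orbT andbT.
    + by exists (A + k * S m) => //; have := S0 m; lia.
  (* The depths of the x-cops other than the lifted one: at most [k1' - 1 < h]. *)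
  pose m' := pmap (fun q => omap (fun v : {bseq H of bool} => size v)
    (D (inl q))) (rem l (iota 0 k1')).
  have lin : l \in iota 0 k1' by rewrite mem_iota.
  apply: (@reach_spine H h _ m' A (A + h.+1 * S m)) => //.
  + rewrite size_pmap; apply: leq_ltn_trans (count_size _ _) _.
    by rewrite size_rem // size_iota /h; lia.
  + move=> p hp [[q|q] nw e]; last by case: (nI q p hp).
    rewrite mem_pmap; apply/mapP; exists q; last by rewrite e /= sz //; lia.
    rewrite mem_rem_uniq ?iota_uniq // inE mem_iota /=; apply/andP; split.
      by apply: contra nw => /eqP ->.
    by apply: (hD (inl q)); rewrite e.
  + by lia.
  + by have := S0 m; lia.
  + by case=> w _; apply: nJ.
  + case=> w nw e; apply: (nK w (A + k * S m)); first by have := S0 m; lia.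
    by rewrite /update (negPf nw).
- have lk : l < k2' := ha _ az.
  have [m0 hc'] := count_spend lk az hc.
  case: m m0 hc' hA nI nJ hi {hc block} bj => // m _ hc' hA nI nJ hi bj.
  move: hA nI nJ hi bj; rewrite SS; set w := h.+1 * S m => hA nI nJ hi bj.
  have hS : 0 < S m <= w by rewrite S0 leq_pmull.
  set J := A + j * _ in nJ hi *.
  have JB : J + 2 * w <= H.+1 by rewrite /J; lia.
  have vp p : p <= H -> v = spine H p -> size v = p by move=> hp ->; exact: sz.
  (* The robber's block has length [2 * w]; if the new cop is in its first half, the second half
     becomes the interval, otherwise the first. *)
  have [A' hA' nv] : exists2 A', J <= A' <= J + w &
      forall i, A' <= i < A' + w -> v <> spine H i.
    have [vin|nvin] := boolP (J <= size v < J + w); [exists (J + w)|exists J];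
      try lia; move=> p hp ev; have {ev} := vp p _ ev; lia.
  have nJ' x p : A' <= p < A' + w -> update D (inr l) v x <> Some (spine H p).
    move=> hp; rewrite /update; case: eqP => _; last by apply: nJ; lia.
    by case; apply: nv.
  exists (spine H A'); last first.
    exists m, A', 0; rewrite -/w mul0n addn0; split; split=> //; try lia.
    + by move=> x; apply: nJ'.
    + by move=> x p hp; apply: nJ'; lia.
    + by exists A' => //; lia.
  (* No other cop stands in the old block, so the list of obstacles is empty, and [h] is positive
     because [k1 > 1]. *)
  apply: (@reach_spine H h _ [::] J (J + 2 * w)) => //; try lia.
  + by rewrite /= /h; lia.
  + by move=> p hp [x _ e]; case: (nJ x p).
  + by case=> x _; apply: nJ; lia.
  + by case=> x _; apply: nJ; lia.
Qed.

Lemma not_logic_le_one_x k2 k2' :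
  0 < k2 -> k2' <= k2.*2 -> ~ logic_le (C_logic 1 k2) (C_logic 0 k2').
Proof.
move=> k2_gt0 le; pose H := k2.*2.
(* Only the parent has to be remembered: even levels share the x-variable, and the [k2] odd levels
   up to [H] get distinct y-variables. *)
pose c i : var := if odd i then inr i./2 else inl 0.
apply: (@not_logic_le_dist _ _ (tree_cfi 1 (fun=> false))
          (tree_cfi 1 (pred1 (node H [::])))).
  apply: (@tree_cfi_dist H 1 c) => [i j ij le1|i hi|i j /andP[ij hj]].
  - have -> : j = i.+1 by lia.
    by rewrite /c /=; case: (odd i).
  - rewrite /c; case: ifP => //= oi.
    by have := odd_double_half i; rewrite /H in hi; lia.
  - rewrite /c; case oi: (odd i) => //=; case oj: (odd j) => //.
    apply/eqP => -[e]; have := odd_double_half i; have := odd_double_half j.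
    by rewrite oi oj e; lia.
(* The subtree below the robber contains no cop, and his depth leaves one level for every y-cop
   still to come. *)
pose I (D : var -> option {bseq H of bool}) (a : pred var) (r : {bseq H of bool}) :=
  [/\ forall w v, D w = Some v -> ~~ suffix r v,
      count (fun i => a (inr i)) (iota 0 k2') + size r <= H
    & forall w, a w -> avail 0 k2' w].
apply: (@cfi_indist _ _ _ _ _ I); last first.
  split=> //; rewrite nodeK // addn0.
  by apply: leq_trans (count_size _ _) _; rewrite size_iota.
split=> [D a r [nr _ _] z /nr|]; first by rewrite suffix_refl.
move=> D a r [l|l] v [nr hc ha] az; first by have := ha _ az.
have lk : l < k2' := ha _ az.
have [m0 hc'] := count_spend lk az (leqnn _).
have ha' w : spend a (inr l) w -> avail 0 k2' w by case/andP => /ha.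
have [sv|nsv] := boolP (suffix r v); last first.
  exists r; first exact: ReachRefl.
  split=> // [w u|]; last by lia.
  by rewrite /update; case: eqP => [_ [<-]|_ /nr].
(* The new cop is in at most one of the two child subtrees; the cop just spent pays for the level
   lost by moving into the other. *)
have [b nb] : exists b, ~~ suffix (b :: r) v.
  have [st|] := boolP (suffix (true :: r) v); last by exists true.
  exists false; apply/negP => sf.
  by have := suffix_same _ st sf => /(_ erefl).
have szr : size (b :: r) <= H by move=> /=; lia.
have br : node H (b :: r) = b :: r :> seq bool by rewrite nodeK.
have up u : suffix (b :: r) u -> suffix r u.
  by apply: suffix_trans; apply: suffix_cons.
exists (node H (b :: r)).
  apply: ReachStep (ReachRefl _ _ _).
  - by apply/orP; right; rewrite /anc br /= ltnSn addn1 leqnn suffix_cons.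
  - by case=> w _ /nr; rewrite suffix_refl.
  - by case=> w _ /nr; rewrite br suffix_cons.
split=> // [w u|]; rewrite br /=; last by lia.
rewrite /update; case: eqP => [_ [<-] //|_ /nr].
by apply: contra; apply: up.
Qed.

(** * The classification *)

Lemma logic_le_iff k1 k2 k1' k2' : 2 <= k1 + k2 ->
  logic_le (C_logic k1 k2) (C_logic k1' k2') <->
  (k1 <= k1' /\ k1 + k2 <= k1' + k2') \/ [/\ k1 = 1, k1' = 0 & 2 * k2 < k2'].
Proof.
move=> hk; split=> [le|[[]|[-> -> lt]]]; last 2 first.
- exact: logic_le_rename.
- by apply: logic_le_one_x; rewrite -mul2n.
have [lt|les] := ltnP (k1' + k2') (k1 + k2); first by case: (not_logic_le_total lt le).
have [le1|lt1] := leqP k1 k1'; first by left.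
have [gt1|le1] := ltnP 1 k1; first by case: (not_logic_le_requant gt1 lt1 le).
have k1E : k1 = 1 by lia.
have k1'E : k1' = 0 by lia.
subst k1 k1'; right; split=> //; rewrite ltnNge mul2n; apply/negP => le2.
by apply: not_logic_le_one_x le2 le; lia.
Qed.

Theorem theorem16 (k1 k2 k1' k2' : nat)
    (hk : 2 <= k1 + k2) (hk' : 2 <= k1' + k2') :
  (logic_lt (C_logic k1 k2) (C_logic k1' k2') <->
     [\/ k1 < k1' /\ k1 + k2 <= k1' + k2',
         k1 <= k1' /\ k1 + k2 < k1' + k2'
       | [/\ k1 = 1, k1' = 0 & 2 * k2 < k2']]) /\
  (logic_equiv (C_logic k1 k2) (C_logic k1' k2') <->
     (k1, k2) = (k1', k2')).
Proof.
have E1 := logic_le_iff k1' k2' hk; have E2 := logic_le_iff k1 k2 hk'.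
split; [split|split].
- case=> /E1 r1 nr2; have {nr2} r2 : ~ (k1' <= k1 /\ k1' + k2' <= k1 + k2).
    by move=> h; apply: nr2; apply/E2; left.
  case: r1 => [[h1 h2]|h]; last exact: Or33.
  by have [h3|h3] := ltnP k1 k1'; [apply: Or31|apply: Or32]; split=> //; lia.
- move=> h; split; first by apply/E1; case: h => -[h1 h2];
    [left; lia|left; lia|right].
  by move/E2 => [[h1 h2]|[h1 h2 h3]]; case: h => [[]|[]|[]]; lia.
- case=> /E1 [[h1 h2]|[h1 h2 h3]] /E2 [[h4 h5]|[h4 h5 h6]]; try lia.
  by congr (_, _); lia.
- by case=> e1 e2; split; [apply/E1|apply/E2]; left; lia.
Qed.
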